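(* Let $r,\delta,n$ be positive integers with $\delta\ge r$ and $n\ge 2(\delta+1)-r$. Let $G$ be a simple graph of order $n$ with vertex connectivity $r$ and minimum degree $\delta$. Then \[\tau(G)\le r\,n^{r-1}(\delta+1)^{\delta-r}(r+n-\delta-1)^{n-\delta-2},\] with equality if and only if $G\cong K_r\vee(K_{\delta-r+1}\cup K_{n-\delta-1})$.
   Context: All graphs are finite and simple. $\tau(G)$ denotes the number of spanning trees of $G$. A vertex cut of a connected graph $G$ is a set $S\subseteq V(G)$ such that $G-S$ is disconnected or a single vertex; the vertex connectivity of $G$ is the minimum size of a vertex cut. $K_m$ is the complete graph on $m$ vertices, $G\cup H$ is the disjoint union, and $G\vee H$ is the join (disjoint union plus all edges between $V(G)$ and $V(H)$). *)

(* Defs.v *)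
From mathcomp Require Import all_boot.

Set Implicit Arguments.
Unset Strict Implicit.
Unset Printing Implicit Defensive.

Record sgraph := SGraph {
  vertex :> finType;
  adj : rel vertex;
  adj_sym : symmetric adj;
  adj_irrefl : irreflexive adj }.

Notation "x -- y" := (adj x y) (at level 30).

Definition isomorphic (G H : sgraph) : Prop :=
  exists2 f : G -> H, bijective f & forall x y : G, (f x -- f y) = (x -- y).

Definition degree (G : sgraph) (x : G) : nat := #|[set y : G | x -- y]|.

(* Every degree is less than #|G|, so the default value #|G| is only
   reached on the graph without vertices. *)
Definition min_degree (G : sgraph) : nat :=
  \big[minn/#|G|]_(x : G) degree x.

(* The graph without vertices counts as connected here. *)
Definition connected (G : sgraph) : bool :=
  [forall x : G, forall y : G, connect (@adj G) x y].

Section DeleteVertices.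
Variables (G : sgraph) (S : {set G}).

Definition del_adj : rel {x : G | x \notin S} := fun x y => val x -- val y.

Lemma del_adj_sym : symmetric del_adj.
Proof. by move=> x y; rewrite /del_adj adj_sym. Qed.

Lemma del_adj_irrefl : irreflexive del_adj.
Proof. by move=> x; rewrite /del_adj adj_irrefl. Qed.

Definition del_vertices : sgraph := SGraph del_adj_sym del_adj_irrefl.

Definition vertex_cut : bool :=
  ~~ connected del_vertices || (#|del_vertices| == 1).

End DeleteVertices.

(* The complement of a vertex is always a vertex cut, so the default value
   #|G| is only reached on the graph without vertices.  On a disconnected
   graph set0 is a vertex cut and the value is 0. *)
Definition vertex_connectivity (G : sgraph) : nat :=
  \big[minn/#|G|]_(S : {set G} | vertex_cut S) #|S|.

(* A cycle has at least three vertices: mathcomp's cycle predicate also holds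
   of the empty sequence and of [:: x; y] for an edge xy.  A duplicate-free
   sequence has size at most #|G|, hence the bound on k. *)
Definition acyclic (G : sgraph) : bool :=
  [forall k : 'I_#|G|.+1, forall c : k.-tuple G,
     (2 < k) ==> ~~ ucycleb (@adj G) c].

Definition tree (G : sgraph) : bool :=
  [&& 0 < #|G|, connected G & acyclic G].

Definition edges (G : sgraph) : {set {set G}} :=
  [set [set p.1; p.2] | p : G * G & p.1 -- p.2].

Section SpanningSubgraph.
Variables (G : sgraph) (F : {set {set G}}).

Definition span_adj : rel G := fun x y => (x != y) && ([set x; y] \in F).

Lemma span_adj_sym : symmetric span_adj.
Proof. by move=> x y; rewrite /span_adj eq_sym setUC. Qed.

Lemma span_adj_irrefl : irreflexive span_adj.
Proof. by move=> x; rewrite /span_adj eqxx. Qed.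

Definition spanning_subgraph : sgraph := SGraph span_adj_sym span_adj_irrefl.

End SpanningSubgraph.

(* A spanning tree is identified with its set of edges. *)
Definition tau (G : sgraph) : nat :=
  #|[set F : {set {set G}} | (F \subset edges G) && tree (spanning_subgraph F)]|.

Section Complete.
Variable m : nat.

Definition complete_adj : rel 'I_m := fun i j => i != j.

Lemma complete_adj_sym : symmetric complete_adj.
Proof. by move=> i j; rewrite /complete_adj eq_sym. Qed.

Lemma complete_adj_irrefl : irreflexive complete_adj.
Proof. by move=> i; rewrite /complete_adj eqxx. Qed.

Definition complete : sgraph := SGraph complete_adj_sym complete_adj_irrefl.

End Complete.

Section UnionJoin.
Variables G H : sgraph.

(* b tells whether vertices of G and vertices of H are adjacent. *)
Definition sum_adj (b : bool) : rel (G + H) := fun u v =>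
  match u, v with
  | inl x, inl y => x -- y
  | inr x, inr y => x -- y
  | _, _ => b
  end.

Lemma sum_adj_sym b : symmetric (sum_adj b).
Proof. by move=> [x|x] [y|y] //=; rewrite adj_sym. Qed.

Lemma sum_adj_irrefl b : irreflexive (sum_adj b).
Proof. by move=> [x|x] /=; rewrite adj_irrefl. Qed.

Definition disjoint_union : sgraph :=
  SGraph (sum_adj_sym false) (sum_adj_irrefl false).

Definition join : sgraph := SGraph (sum_adj_sym true) (sum_adj_irrefl true).

End UnionJoin.

(* Main.v *)
Require Import Defs.
From mathcomp Require Import all_boot all_order all_algebra perm zify ring.

(* A minimum vertex cut S with |S| = r splits the other vertices into two
   nonempty sets A and B without edges in between, so G is a spanning subgraph
   of K_r \/ (K_a u K_b) with a = |A|, b = |B|; the degree bound gives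
   a, b >= delta - r + 1.  Adding an edge strictly increases the number of
   spanning trees, and tau (K_r \/ (K_a u K_b)) =
   r n^(r-1) (r+a)^(a-1) (r+b)^(b-1), which is largest when a and b are as far
   apart as possible because (r+a)^(a-1) is strictly log-convex in a.

   Spanning trees rooted at x are counted as parent functions all of whose
   orbits reach x.  Expanding the reduced Laplacian determinant multilinearly
   along its rows gives the sum of det (1 - P_f) over all f choosing a neighbor
   of each vertex, and this summand is 1 if f is a parent function and 0
   otherwise.  For K_r \/ (K_a u K_b) the Laplacian is D (1 - X Y) with D
   diagonal and X Y of rank at most 3, and det (1 - X Y) = det (1 - Y X) is a
   determinant of order 3. *)

Set Implicit Arguments.
Unset Strict Implicit.
Unset Printing Implicit Defensive.

Import GRing.Theory Num.Theory.

(** * Spanning trees as parent functions directed to a root *)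

Lemma eq_set2 (T : finType) (x y v w : T) :
  x != y -> [set x; y] = [set v; w] -> x = v /\ y = w \/ x = w /\ y = v.
Proof.
move=> nxy exy.
have := set21 x y; have := set22 x y; rewrite exy !inE.
by case/orP=> /eqP yE /orP[] /eqP xE; move: nxy; rewrite xE yE ?eqxx; auto.
Qed.

Section RootedFunctions.
Variable G : sgraph.
Implicit Types (f g : {ffun G -> G}) (v w x : G).

(** The root is its own parent, so that a parent function is total and each spanning tree has
    exactly one. *)
Definition rooted x : {set {ffun G -> G}} :=
  [set f : {ffun G -> G} |
    [forall v, (if v == x then f v == x else v -- f v) && fconnect f v x]].

Definition fedges x f : {set {set G}} := [set [set v; f v] | v in [set~ x]].

Lemma rootedP x f :
  reflect [/\ f x = x, forall v, v != x -> v -- f v & forall v, fconnect f v x]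
          (f \in rooted x).
Proof.
rewrite inE; apply: (iffP forallP) => [fP | [fx fv fc] v].
  split=> [|v /negPf nvx|v]; last by case/andP: (fP v).
    by have /andP[] := fP x; rewrite eqxx => /eqP.
  by have /andP[] := fP v; rewrite nvx.
by rewrite fc andbT; case: eqP => [->|/eqP/fv //]; rewrite fx.
Qed.

Lemma rooted_height x f : f \in rooted x ->
  exists h : G -> nat, forall v, v != x -> h (f v) < h v.
Proof.
case/rootedP=> _ _ fc.
have ex v : exists k, iter k f v == x.
  by exists (findex f v x); rewrite iter_findex.
(* The height is the least number of steps of [f] that lead to the root. *)
exists (fun v => ex_minn (ex v)) => v nvx.
case: (ex_minnP (ex v)) => [[|k]]; first by rewrite /= (negPf nvx).
rewrite iterSr => kP _; case: ex_minnP => m _ /(_ _ kP); exact.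
Qed.

Lemma height_rooted x f (h : G -> nat) :
  f x = x -> (forall v, v != x -> v -- f v) ->
  (forall v, v != x -> h (f v) < h v) -> f \in rooted x.
Proof.
move=> fx fv fh; apply/rootedP; split=> // v.
have [n] := ubnP (h v); elim: n v => // n IHn v le_hv.
have [->|nvx] := eqVneq v x; first exact: connect0.
apply: connect_trans (fconnect1 _ _) (IHn _ _).
by have := fh v nvx; lia.
Qed.

Lemma mem_fedges x f v w : v != w ->
  ([set v; w] \in fedges x f) =
    (v != x) && (f v == w) || (w != x) && (f w == v).
Proof.
move=> nvw; apply/imsetP/orP => [[u + /(eq_set2 nvw)]|].
  by rewrite !inE => nux [[-> ->]|[-> ->]]; rewrite nux eqxx; auto.
case=> /andP[nx /eqP <-]; first by exists v; rewrite ?inE.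
by exists w; rewrite ?inE // setUC.
Qed.

Lemma fedges_sub x f : f \in rooted x -> fedges x f \subset edges G.
Proof.
case/rootedP=> _ fv _; apply/subsetP => _ /imsetP[v + ->]; rewrite !inE => nvx.
by apply/imsetP; exists (v, f v); rewrite ?inE ?fv.
Qed.

Lemma span_fedges x f v : f \in rooted x -> v != x ->
  span_adj (fedges x f) v (f v).
Proof.
case/rootedP=> _ fv _ nvx; have nvf : v != f v.
  by apply: contraTneq (fv v nvx) => {1}->; rewrite adj_irrefl.
by rewrite /span_adj mem_fedges // nvx eqxx nvf.
Qed.

Lemma span_fedges_connect x f v w : f \in rooted x ->
  connect (span_adj (fedges x f)) v w.
Proof.
move=> fP; have [h hP] := rooted_height fP.
have cx u : connect (span_adj (fedges x f)) u x.
  have [n] := ubnP (h u); elim: n u => // n IHn u le_hu.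
  have [->|nux] := eqVneq u x; first exact: connect0.
  apply: connect_trans (connect1 (span_fedges fP nux)) (IHn _ _).
  by have := hP u nux; lia.
by apply: connect_trans (cx v) _; rewrite (sym_connect_sym (@span_adj_sym _ _)) cx.
Qed.

(** On a cycle, both neighbors of a vertex of maximal height have to be its parent, so they
    coincide. *)
Lemma fedges_acyclic x f : f \in rooted x ->
  acyclic (spanning_subgraph (fedges x f)).
Proof.
move=> fP; have [h hP] := rooted_height fP.
apply/forallP => k; apply/forallP => c; apply/implyP => lt2k.
apply/negP; rewrite /ucycleb => /andP[].
have: 2 < size c by rewrite size_tuple.
move: (tval c) => {lt2k k}c lt2c cyc uc.
have [v vc vmax] : exists2 v, v \in c & forall w, w \in c -> h w <= h v.
  case: c lt2c {cyc uc} => // u c _.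
  have := @arg_maxnP _ u (mem (u :: c)) h (mem_head _ _).
  by case=> v; exists v.
have [i p pE] := rot_to vc.
move: cyc uc lt2c; rewrite -(rot_cycle i) -(rot_uniq i) -(size_rot i) pE.
have {}vmax w : w \in v :: p -> h w <= h v by rewrite -pE mem_rot; exact: vmax.
have nbr w : w \in v :: p -> span_adj (fedges x f) v w -> w = f v.
  move=> /vmax le_w /andP[nvw]; rewrite mem_fedges // => /orP[]/andP[nx /eqP] //.
  by move=> fw; have := hP w nx; rewrite fw; lia.
case: p pE vmax nbr => // w p _ _; case/lastP: p => // p u nbr.
rewrite /= rcons_path last_rcons => /and3P[evw _ euv] /andP[_].
have wf : w = f v by apply: nbr; rewrite ?inE ?eqxx ?orbT.
have uf : u = f v.
  apply: nbr; first by rewrite !inE mem_rcons mem_head !orbT.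
  by move: euv; rewrite /= span_adj_sym.
by rewrite wf uf mem_rcons mem_head.
Qed.

(** Where [f u] and [g u] differ, [g] can only obtain the edge from [u] to [f u] by sending [f u]
    back to [u]. Heights forbid this for [f], so the two also differ at [f u], and so on up to the
    root, where they agree. *)
Lemma fedges_inj x : {in rooted x &, injective (fedges x)}.
Proof.
move=> f g fP gP efg; apply/ffunP => v; apply/eqP/negPn/negP => bad0.
have /rootedP[fx fv fc] := fP; have /rootedP[gx gv _] := gP.
have [h hP] := rooted_height fP.
have step u : f u != g u -> f (f u) != g (f u).
  move=> bad; have nux : u != x by apply: contraNneq bad => ->; rewrite fx gx.
  have /andP[nuf] := span_fedges fP nux.
  rewrite efg mem_fedges // [g u == _]eq_sym (negPf bad) andbF /=.
  case/andP=> nfx /eqP ->; apply/eqP => ffu.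
  by have := hP _ nux; have := hP _ nfx; rewrite ffu; lia.
have bad k : f (iter k f v) != g (iter k f v) by elim: k => //= k; exact: step.
by have := bad (findex f v x); rewrite iter_findex // fx gx eqxx.
Qed.

End RootedFunctions.

Lemma connect_height (T : finType) (e : rel T) (x : T) :
  (forall v, connect e v x) ->
  exists h : T -> nat, forall v, v != x -> exists2 w, e v w & h w < h v.
Proof.
move=> cx.
have ex v : exists n, [exists t : n.-tuple T, path e v t && (last v t == x)].
  have /connectP[p ep xE] := cx v.
  by exists (size p); apply/existsP; exists (in_tuple p); rewrite ep -xE eqxx.
(* Here the height is the distance to [x]. *)
exists (fun v => ex_minn (ex v)) => v nvx.
case: (ex_minnP (ex v)) => n /existsP[[[|w p] /= /eqP <-]] => [|+ _].
  by rewrite (negPf nvx).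
case/andP=> /andP[evw ep] lp; exists w => //.
case: ex_minnP => m _; apply; apply/existsP; exists (in_tuple p).
by rewrite ep lp.
Qed.

(** Each vertex is sent to a neighbor closer to [x]. Sending all neighbors of [x] straight to [x]
    gives a tree through any prescribed edge at [x]. *)
Lemma connected_rooted (G : sgraph) (x : G) : connected G ->
  exists2 f, f \in rooted x & forall v, v -- x -> f v = x.
Proof.
move=> /forallP cG; have {}cG v : connect (@adj G) v x.
  by have /forallP := cG v; exact.
have [h hP] := connect_height cG.
pose f := [ffun v : G => if (v == x) || (v -- x) then x else
                         odflt x [pick w | v -- w & h w < h v]].
exists f => [|v vx]; last by rewrite ffunE vx orbT.
have fP v : v != x -> v -- f v /\ (v -- x \/ h (f v) < h v).
  move=> nvx; rewrite ffunE (negPf nvx) /=; case: ifP => [|_]; first by auto.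
  case: pickP => [w /andP[]|none]; first by auto.
  by have [w ew lw] := hP v nvx; have := none w; rewrite ew lw.
(* The root gets height 0 and all others are shifted by one, because the neighbors of [x] go to [x]
   whatever [h] says. *)
apply: (@height_rooted _ x f (fun v => if v == x then 0 else (h v).+1)).
- by rewrite ffunE eqxx.
- by move=> v /fP[].
move=> v nvx; rewrite (negPf nvx); case: eqP => // nfx.
have [_ []] := fP v nvx => // vx.
by case: nfx; rewrite ffunE vx orbT.
Qed.

Lemma tau_rooted (G : sgraph) (x : G) : tau G = #|rooted x|.
Proof.
rewrite -(card_in_imset (@fedges_inj G x)); apply: eq_card => F.
rewrite inE; apply/andP/imsetP => [[sF /and3P[_ cF aF]] | [f fP ->]]; last first.
  split; first exact: fedges_sub.
  apply/and3P; split; last exact: fedges_acyclic.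
    by apply/card_gt0P; exists x.
  by apply/forallP=> v; apply/forallP=> w; exact: (@span_fedges_connect G).
have [f fP _] := @connected_rooted (spanning_subgraph F) x cF.
have /rootedP[/= fx fv fc] := fP.
have sFE (e : {set G}) : e \in F -> exists v w : G, v -- w /\ e = [set v; w].
  move=> /(subsetP sF)/imsetP[[v w]]; rewrite inE /= => vw ->.
  by exists v, w.
have adjF v w : span_adj F v w -> v -- w.
  move=> /andP[nvw /sFE[v' [w' [vw']]]] /(eq_set2 nvw)[[-> ->]//|[-> ->]].
  by rewrite adj_sym.
have fG : f \in rooted (x : G).
  by apply/rootedP; split=> // v /fv/adjF.
exists f => //; apply/setP => e.
have fF : fedges x f \subset F.
  by apply/subsetP=> _ /imsetP[v + ->]; rewrite !inE => /fv/andP[].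
apply/idP/idP => [eF|]; last exact: (subsetP fF).
have [v [w [vw eE]]] := sFE e eF; rewrite eE; apply: contraT => neF.
have nvw : v != w by apply: contraTneq vw => ->; rewrite adj_irrefl.
(* A further edge of [F] would close the path between its ends along [fedges x f] to a cycle. *)
have /connectP[p0 /shortenP[p ep up _] wE] := span_fedges_connect v w fG.
have /forallP/(_ (Ordinal (_ : size (v :: p) < #|G|.+1))) := aF.
have szp : size (v :: p) < #|G|.+1 by rewrite ltnS -(card_uniqP up) max_card.
move=> /(_ szp)/forallP/(_ (in_tuple (v :: p)))/implyP/=.
(* A path with one vertex gives [v = w], and one with two vertices puts the edge into [fedges x f];
   a longer one closes to a cycle. *)
case: p ep up wE szp => [|u [|u' p]] ep up wE szp.
- by rewrite wE /= eqxx in nvw.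
- by move: ep neF; rewrite /= andbT /= wE => /andP[_ ->].
move=> /(_ isT)/negP; case; rewrite /ucycleb up andbT /cycle rcons_path.
rewrite -wE; apply/andP; split; last first.
  by rewrite /= /span_adj eq_sym nvw setUC -eE.
apply: sub_path ep => y z /andP[nyz yz].
by rewrite /= /span_adj nyz (subsetP fF).
Qed.

(** * Determinants and the matrix-tree theorem *)

(** Sylvester's determinant identity: one block matrix is factored into block triangular ones in two
    ways. *)
Lemma det1_subM_comm (R : comNzRingType) m n
    (X : 'M[R]_(m, n)) (Y : 'M[R]_(n, m)) :
  (\det (1%:M - X *m Y) = \det (1%:M - Y *m X))%R.
Proof.
have E1 : (block_mx 1%:M X Y 1%:M =
  block_mx 1%:M 0 Y 1%:M *m block_mx 1%:M X 0 (1%:M - Y *m X))%R.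
  by rewrite mulmx_block !(mul1mx, mulmx1, mul0mx, mulmx0, addr0, add0r) addrC subrK.
have E2 : (block_mx 1%:M X Y 1%:M =
  block_mx (1%:M - X *m Y) X 0 1%:M *m block_mx 1%:M 0 Y 1%:M)%R.
  by rewrite mulmx_block !(mul1mx, mulmx1, mul0mx, mulmx0, addr0, add0r) subrK.
have := congr1 determinant E1; rewrite E2 !det_mulmx !det_lblock !det_ublock.
by rewrite !det1 !(mul1r, mulr1).
Qed.

Section MatrixTree.
Variables (F : fieldType) (G : sgraph) (x : G).
Local Open Scope ring_scope.

Definition on_enum (M : G -> G -> F) : 'M[F]_#|G| :=
  \matrix_(i, j) M (enum_val i) (enum_val j).

Definition parent_option (v w : G) : bool :=
  if v == x then w == x else v -- w.

(** The row of [v] in [1 - P_f] when [f v = w]; the root, having no parent, keeps a unit row. *)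
Definition arc_row (v w u : G) : F := (u == v)%:R - ((v != x) && (u == w))%:R.

(* Instead of deleting the row and the column of the root from the Laplacian,
   the row of the root is replaced by a unit vector. *)
Definition rooted_laplacian : G -> G -> F :=
  fun v u => \sum_(w | parent_option v w) arc_row v w u.

Lemma det_on_enum (M : G -> G -> F) :
  \det (on_enum M) = \sum_(s : {perm 'I_#|G|})
    (-1) ^+ s * \prod_v M v (enum_val (s (enum_rank v))).
Proof.
apply: eq_bigr => s _; congr (_ * _).
rewrite (reindex enum_rank) /=; last exact: onW_bij (@enum_rank_bij G).
by apply: eq_bigr => v _; rewrite mxE enum_rankK.
Qed.

Lemma det_rooted (f : {ffun G -> G}) : f \in rooted x ->
  \det (on_enum (fun v => arc_row v (f v))) = 1.
Proof.
move=> fP; have /rootedP[fx fv fc] := fP; have [h hP] := rooted_height fP.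
(* A nonzero term of the Leibniz formula has s i = i or s i = f i for all i; the
   f-orbit of a point moved by s would consist of moved points, but it meets
   the root. *)
rewrite det_on_enum (bigD1 (1%g : 'S_#|G|)) //= odd_perm1 mul1r big1 => [|v _].
  rewrite big1 ?addr0 // => s ns1.
  have [i nsi] : exists i, s i != i.
    apply/existsP; rewrite -negb_forall; apply: contraNN ns1 => /forallP sid.
    by apply/eqP/permP => i; rewrite perm1; apply/eqP.
  apply/eqP; rewrite mulf_eq0 signr_eq0 /=; apply: contraT => /prodf_neq0 nz.
  have sE j : s j != j -> (enum_val j != x) && (enum_val (s j) == f (enum_val j)).
    move=> nsj; have := nz (enum_val j) isT.
    rewrite enum_valK /arc_row (inj_eq enum_val_inj) (negPf nsj) sub0r oppr_eq0.
    by case: (_ && _); rewrite ?eqxx.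
  have sk k : enum_val (iter k s i) = iter k f (enum_val i) /\
              s (iter k s i) != iter k s i.
    elim: k => [|k [IH1 IH2]] //=; have /andP[_ /eqP ->] := sE _ IH2.
    by rewrite IH1 (inj_eq perm_inj).
  have [] := sk (findex f (enum_val i) x); rewrite iter_findex // => ex /sE.
  by rewrite ex eqxx.
(* The diagonal entries are 1: as heights decrease, no vertex but the root is its own parent. *)
rewrite perm1 enum_rankK /arc_row eqxx; case: eqP => /= [_|/eqP /hP]; first exact: subr0.
by case: eqP => [{2}->|_ _]; rewrite ?ltnn ?subr0.
Qed.

Lemma det_not_rooted (f : {ffun G -> G}) :
  f \in family parent_option -> f \notin rooted x ->
  \det (on_enum (fun v => arc_row v (f v))) = 0.
Proof.
move=> /familyP fQ nfP.
have fx : f x = x by have := fQ x; rewrite /in_mem /= /parent_option eqxx => /eqP.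
have /existsP[u nu] : [exists u, ~~ fconnect f u x].
  rewrite -negb_forall; apply: contraNN nfP => /forallP fc; apply/rootedP; split=> //.
  by move=> v /negPf nvx; have := fQ v; rewrite /in_mem /= /parent_option nvx.
(* The indicator of the vertices that never reach the root is in the kernel. *)
rewrite -det_tr; apply/eqP/det0P.
exists (\row_i (~~ fconnect f (enum_val i) x)%:R).
  apply/eqP => /rowP /(_ (enum_rank u)); rewrite !mxE enum_rankK nu => /eqP.
  by rewrite oner_eq0.
apply/rowP => i; rewrite !mxE.
under eq_bigr do rewrite !mxE.
rewrite -(big_enum_val (A := predT) (fun v => (~~ fconnect f v x)%:R *
  arc_row (enum_val i) (f (enum_val i)) v)) /=.
set v := enum_val i; rewrite /arc_row.
under eq_bigr do rewrite mulrBr.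
rewrite sumrB (bigD1 v) //= eqxx mulr1 big1 => [|w /negPf ->]; last by rewrite mulr0.
rewrite (bigD1 (f v)) //= eqxx andbT big1 => [|w /negPf ->]; last by rewrite andbF mulr0.
rewrite !addr0; have [->|nvx] := eqVneq v x; first by rewrite connect0 mulr0 subrr.
rewrite mulr1; suff -> : fconnect f v x = fconnect f (f v) x by rewrite subrr.
apply/idP/idP => [c|]; last exact: connect_trans (fconnect1 _ _).
have /iter_findex := c; case: findex => [/= /eqP|k]; first by rewrite (negPf nvx).
by rewrite iterSr => <-; exact: fconnect_iter.
Qed.

Lemma rooted_det : \det (on_enum rooted_laplacian) = #|rooted x|%:R.
Proof.
have -> : \det (on_enum rooted_laplacian) =
    \sum_(f in family parent_option) \det (on_enum (fun v => arc_row v (f v))).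
  rewrite det_on_enum.
  (* Distributing the product over the row sums leaves one term for each choice of an option at
     every vertex. *)
  under eq_bigr do rewrite bigA_distr_big_dep big_distrr /=.
  by rewrite exchange_big /=; apply: eq_bigr => f _; rewrite det_on_enum.
rewrite (bigID (mem (rooted x))) /= [X in _ + X]big1 ?addr0; last first.
  by move=> f /andP[]; exact: det_not_rooted.
rewrite -[#|rooted x|]sum1_card natr_sum; apply: eq_big => [f|f /andP[_ /det_rooted]//].
rewrite andb_idl // => /rootedP[fx fv _]; apply/familyP => v.
by rewrite /in_mem /= /parent_option; case: eqP => [->|/eqP/fv //]; rewrite fx.
Qed.

End MatrixTree.

(** * Counting the spanning trees of K_r \/ (K_a u K_b) *)

(** Color 0 marks the cut and colors 1 and 2 its two sides, between which no edge may run. *)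
Definition separated (k l : 'I_3) : bool := [&& 0 < k, 0 < l & k != l].

Lemma separatedC k l : separated k l = separated l k.
Proof. by rewrite /separated andbCA eq_sym. Qed.

(** With [q l] the sum of column [l] of the matrix [X] below, this is the matrix [1 - Y X] of a
    colored join. *)
Lemma det_class_matrix (R : comNzRingType) (q : 'I_3 -> R) :
  (\det (\matrix_(k, l) ((k == l)%:R - (~~ separated k l)%:R * q l)) =
   (1 - q ord0) * (1 - q 1) * (1 - q 2%:R) - q ord0 * q 1 * (1 - q 2%:R)
     - q ord0 * q 2%:R * (1 - q 1))%R.
Proof.
rewrite (expand_det_row _ ord0) !big_ord_recl big_ord0 /cofactor.
rewrite !(expand_det_row _ (ord0 : 'I_2)) !big_ord_recl !big_ord0 /cofactor.
rewrite !det_mx11 !mxE /separated /=.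
have -> : lift ord0 ord0 = 1%R :> 'I_3 by apply/val_inj.
have -> : lift ord0 (lift ord0 ord0) = 2%:R%R :> 'I_3 by apply/val_inj.
rewrite (_ : lift 1%R ord0 = ord0 :> 'I_3); last exact/val_inj.
rewrite (_ : lift 1%R (lift ord0 0%R) = 2%:R%R :> 'I_3); last exact/val_inj.
rewrite (_ : lift 2%:R%R ord0 = ord0 :> 'I_3); last exact/val_inj.
rewrite (_ : lift 2%:R%R (lift ord0 ord0) = 1%R :> 'I_3); last exact/val_inj.
rewrite /bump /= ?addn0 ?add0n.
rewrite (_ : lift 2%:R%R (lift (lift ord0 ord0) 0%R) = ord0 :> 'I_3); last exact/val_inj.
ring.
Qed.

Section ColoredGraph.
Variables (G : sgraph) (c : G -> 'I_3).

Definition color_class (k : 'I_3) : {set G} := [set v | c v == k].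

(* The classes of colors 0, 1, 2 play the roles of K_r, K_a, K_b in
   K_r \/ (K_a u K_b). *)
Definition colored_join : Prop :=
  forall v w, (v -- w) = (v != w) && ~~ separated (c v) (c w).

(** In a colored join this is the size of the closed neighborhood of a vertex of color [k], one more
    than its degree. *)
Let sees (k : 'I_3) : nat := #|[set w | ~~ separated k (c w)]|.

Section Laplacian.
Variable x : G.
Hypothesis cG : colored_join.
Local Open Scope ring_scope.

(** Adding the identity to the adjacency matrix makes its rows depend on colors only, so it factors
    through the three colors; the diagonal then holds degrees plus one. The root has a unit row,
    hence the entry 1 in [D] and a zero row in [X]. *)
Let D (v : G) : rat := if v == x then 1 else (sees (c v))%:R.
Let X (v : G) (k : 'I_3) : rat := ((v != x) && (c v == k))%:R / D v.
Let Y (k : 'I_3) (u : G) : rat := (~~ separated k (c u))%:R.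

Lemma sees_gt0 v : (0 < sees (c v))%N.
Proof. by apply/card_gt0P; exists v; rewrite inE /separated eqxx !andbF. Qed.

Lemma D_neq0 v : D v != 0.
Proof. rewrite /D; case: (v == x); first exact: oner_neq0.
by rewrite pnatr_eq0 -lt0n sees_gt0. Qed.

Lemma colored_laplacianE v u : rooted_laplacian rat x v u =
  D v * ((u == v)%:R - \sum_k X v k * Y k u).
Proof.
have -> : \sum_k X v k * Y k u = (v != x)%:R / D v * Y (c v) u.
  rewrite (bigD1 (c v)) //= big1 => [|k /negPf nk]; last first.
    by rewrite /X [c v == k]eq_sym nk andbF !mul0r.
  by rewrite /X eqxx andbT addr0.
rewrite mulrBr [_ / D v]mulrC mulrA mulVKf ?D_neq0 //.
rewrite /rooted_laplacian /parent_option /arc_row /D.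
case: eqP => [->|/eqP nvx] /=.
  by rewrite big_pred1_eq mul0r !subr0 mul1r.
rewrite sumrB mul1r sumr_const.
have -> : sees (c v) = #|[pred w | v -- w]|.+1.
  rewrite /sees (cardsD1 v) inE {1}/separated eqxx !andbF add1n; congr _.+1.
  by apply: eq_card => w; rewrite !inE cG eq_sym.
rewrite -[in RHS]natr1 mulrDl mul1r -addrA mulrC mulr_natr; congr (_ + _).
rewrite [X in - X](_ : _ = (v -- u)%:R); last first.
  case vu : (v -- u); last first.
    by apply: big1 => w vw; case: eqP => // uw; rewrite uw vw in vu.
  rewrite (bigD1 u) //= eqxx big1 ?addr0 // => w /andP[_].
  by rewrite eq_sym => /negPf ->.
rewrite cG /Y eq_sym; case: eqP => [->|] /=; last by rewrite add0r.
by rewrite /separated eqxx !andbF /= subrr oppr0.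
Qed.

Let q (k : 'I_3) : rat := #|[pred v | (v != x) && (c v == k)]|%:R / (sees k)%:R.

Lemma colored_det : #|rooted x|%:R =
  (\prod_k (sees k)%:R ^+ #|[pred v | (v != x) && (c v == k)]|) *
  ((1 - q ord0) * (1 - q 1) * (1 - q 2%:R) - q ord0 * q 1 * (1 - q 2%:R)
     - q ord0 * q 2%:R * (1 - q 1)).
Proof.
rewrite -rooted_det -det_class_matrix.
pose XM : 'M[rat]_(#|G|, 3) := \matrix_(i, k) X (enum_val i) k.
pose YM : 'M[rat]_(3, #|G|) := \matrix_(k, i) Y k (enum_val i).
have -> : on_enum (rooted_laplacian rat x) =
    diag_mx (\row_i D (enum_val i)) *m (1%:M - XM *m YM).
  apply/matrixP => i j; rewrite mul_diag_mx !mxE colored_laplacianE.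
  rewrite (inj_eq enum_val_inj) eq_sym; congr (_ * (_ - _)).
  by apply: eq_bigr => k _; rewrite !mxE.
rewrite det_mulmx det_diag det1_subM_comm; congr (_ * _).
  under eq_bigr do rewrite mxE.
  rewrite -(big_enum_val (A := predT) D) (bigD1 x) //= {1}/D eqxx mul1r.
  rewrite (partition_big c predT) //=; apply: eq_bigr => k _.
  rewrite -prodr_const; apply: eq_bigr => v /andP[nvx /eqP cv].
  by rewrite /D (negPf nvx) cv.
congr (\det _); apply/matrixP => k l; rewrite !mxE; congr (_ - _).
under eq_bigr do rewrite !mxE.
rewrite -(big_enum_val (A := predT) (fun v => Y k v * X v l)) /=.
rewrite /q -sum1_card natr_sum mulr_suml mulr_sumr.
rewrite big_mkcond [RHS]big_mkcond /=; apply: eq_bigr => v _.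
rewrite /Y /X /D inE; case: (v == x) => /=; first by rewrite !(mul0r, mulr0).
have [->|_] := eqVneq (c v) l; last by rewrite !(mul0r, mulr0).
by rewrite mul1r.
Qed.

End Laplacian.

(** With the root in class 0 and n = r + a + b, the values of [q] are (r-1)/n, a/(r+a) and b/(r+b).
    The determinant of order 3 becomes r/((r+a)(r+b)), which lowers the exponents a and b by one. *)
Lemma tau_colored_join r a b : colored_join ->
  #|color_class ord0| = r -> #|color_class 1%R| = a ->
  #|color_class 2%:R%R| = b -> 0 < r -> 0 < a -> 0 < b ->
  tau G = r * (r + a + b) ^ (r - 1) * (r + a) ^ (a - 1) * (r + b) ^ (b - 1).
Proof.
move=> cG cr ca cb r0 a0 b0.
have /card_gt0P[x xr] : 0 < #|color_class ord0| by rewrite cr.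
have cx : c x = ord0 by move: xr; rewrite inE => /eqP.
have nx k : k != ord0 ->
    #|[pred v | (v != x) && (c v == k)]| = #|color_class k|.
  move=> nk; apply: eq_card => v; rewrite !inE andb_idl // => /eqP cv.
  by apply: contraNneq nk => vx; rewrite -cv vx cx.
have n0 : #|[pred v | (v != x) && (c v == ord0)]| = r - 1.
  rewrite -cr (cardsD1 x) xr add1n subn1; apply: eq_card => v.
  by rewrite !inE.
have card3 (P : pred 'I_3) : #|[set v | P (c v)]| =
    P ord0 * r + P 1%R * a + P 2%:R%R * b.
  have ord3 k : [|| k == ord0, k == 1%R | k == 2%:R%R :> 'I_3].
    by case: k => [[|[|[]]]].
  have -> : #|[set v | P (c v)]| = \sum_k P k * #|color_class k|.
    rewrite -sum1_card (partition_big c predT) //=; apply: eq_bigr => k _.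
    rewrite -sum1_card; case Pk: (P k); rewrite ?mul1n ?mul0n.
      apply: eq_bigl => v; rewrite !inE andb_idl // => /eqP ->.
      by rewrite Pk.
    by apply: big_pred0 => v; rewrite inE; case: eqP => [->|]; rewrite ?andbF ?Pk.
  rewrite !big_ord_recl big_ord0 cr -ca -cb.
  have -> : lift ord0 ord0 = 1%R :> 'I_3 by apply/val_inj.
  have -> : lift ord0 (lift ord0 ord0) = 2%:R%R :> 'I_3 by apply/val_inj.
  by rewrite addn0 addnA.
apply/eqP; rewrite -(eqr_nat rat) (tau_rooted x) (colored_det x cG).
rewrite !big_ord_recl big_ord0 mulr1.
have -> : lift ord0 ord0 = 1%R :> 'I_3 by apply/val_inj.
have -> : lift ord0 (lift ord0 ord0) = 2%:R%R :> 'I_3 by apply/val_inj.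
rewrite (nx 1%R) // (nx 2%:R%R) // n0 ca cb /sees !(card3 (fun k => ~~ separated _ k)).
rewrite /separated /= !(mul1n, mul0n, addn0).
case: r a b r0 a0 b0 {cr ca cb n0 card3} => [|r] [|a] [|b] // _ _ _.
rewrite !subn1 /= !natrM !natrX !exprS; apply/eqP.
have nz k : (k.+1%:R : rat)%R != 0%R by rewrite pnatr_eq0.
have := nz (r.+1 + a.+1 + b)%N; have := nz (r.+1 + b)%N; have := nz (r.+1 + a)%N.
rewrite -!addnS !natrD -!natr1 => nza nzb nzn.
field; by rewrite nza nzb nzn.
Qed.
End ColoredGraph.

(** * Strict log-convexity of (r+a)^(a-1) *)

(** Bernoulli's inequality (1 - 1/M)^j >= 1 - j/M without denominators; truncated subtraction makes
    the left side 0 once j >= M. *)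
Lemma bernoulli_pred M j : (M - j) * M ^ j <= (M - 1) ^ j * M.
Proof.
elim: j => [|j IHj]; first by rewrite subn0 !expn0 mulnC.
rewrite !expnS; have [le_Mj|lt_jM] := leqP M j.
  by rewrite (_ : M - j.+1 = 0) ?mul0n //; lia.
have : (M - j.+1) * M <= (M - 1) * (M - j) by nia.
by move=> /(leq_mul (leqnn (M ^ j))); nia.
Qed.

Definition clique_factor r a := (r + a) ^ (a - 1).

Lemma clique_factor_gt0 r a : 0 < r -> 0 < clique_factor r a.
Proof. by move=> r0; rewrite expn_gt0 addn_gt0 r0. Qed.

(** Let m = r + a + 1, M = m^2 and j = a - 1. As (m-1)(m+1) = M - 1, the claim reads M^(j+1) <
    (M-1)^j (m+1)^2. Bernoulli's inequality reduces it to M^2 < (M-j)(m+1)^2, which holds because j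
    < m. *)
Lemma clique_factor_logconvex r a : 0 < r -> 0 < a ->
  clique_factor r a.+1 * clique_factor r a.+1
    < clique_factor r a * clique_factor r a.+2.
Proof.
move=> r0; case: a => // j _; rewrite /clique_factor !subn1 /= !addnS.
set m := (r + j).+2; rewrite -[(r + j).+1]/(m.-1).
have m2 : 1 < m by [].
have jm : j.+2 < m.+1 by rewrite /m; lia.
pose M := m * m.
have E1 : m ^ j.+1 * m ^ j.+1 = M * M ^ j by rewrite -expnMn expnS.
have E2 : m.-1 ^ j * m.+1 ^ j.+2 = (M - 1) ^ j * (m.+1 * m.+1).
  rewrite (_ : M - 1 = m.-1 * m.+1); last by rewrite /M; nia.
  by rewrite expnMn !expnS; nia.
rewrite E1 E2 -(ltn_pmul2l (_ : 0 < M)); last by rewrite /M; nia.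
have : M ^ j * (M * M) < M ^ j * ((M - j) * (m.+1 * m.+1)).
  rewrite ltn_pmul2l ?expn_gt0 ?muln_gt0 ?(ltnW m2) //.
  have : M - m < M - j by rewrite /M; nia.
  have : M * M < (M - m) * (m.+1 * m.+1) by rewrite /M; nia.
  nia.
have := bernoulli_pred M j; nia.
Qed.

(** By log-convexity the ratios of consecutive factors increase, so moving a vertex from the smaller
    clique to the larger one gains. *)
Lemma clique_factor_spread r a b : 0 < r -> 0 < a -> a < b ->
  clique_factor r a.+1 * clique_factor r b
    < clique_factor r a * clique_factor r b.+1.
Proof.
move=> r0 a0; elim: b => // b IHb; rewrite ltnS leq_eqVlt => /orP[/eqP <-|ab].
  exact: clique_factor_logconvex.
have := IHb ab; have := clique_factor_logconvex r0 (ltn_trans a0 ab).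
have := clique_factor_gt0 a r0; have := clique_factor_gt0 b r0.
have := clique_factor_gt0 a.+1 r0; have := clique_factor_gt0 b.+1 r0.
move: (clique_factor _ _) (clique_factor _ _) (clique_factor _ _)
  (clique_factor _ _) (clique_factor _ _) => F4 F3 F2 F1 F5 p1 p2 p3 p4 l1 l2.
(* Multiplied by the factor of [b], the claim follows by chaining the induction hypothesis with
   log-convexity at [b]. *)
rewrite -(ltn_pmul2r p3); apply: (@leq_trans (F3 * F5 * F5)).
  by rewrite mulnAC ltn_pmul2r.
by rewrite -!mulnA leq_pmul2l // [F4 * F2]mulnC ltnW.
Qed.

(** The [k] surplus vertices move to the larger clique one at a time, each with a strict gain. *)
Lemma clique_factor_max r a b k : 0 < r -> 0 < a -> a + k <= b ->
  clique_factor r (a + k) * clique_factor r b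
    <= clique_factor r a * clique_factor r (b + k) ?= iff (k == 0).
Proof.
move=> r0 a0; elim: k b => [|k IHk] b le_b; first by rewrite !addn0; exact/leqif_refl.
rewrite addnS -[b + k.+1]addSnnS; apply/leqifP.
apply: (@leq_trans (clique_factor r (a + k) * clique_factor r b.+1)).
  by apply: clique_factor_spread; lia.
by apply: (IHk b.+1 _).1; lia.
Qed.

(** * Monotonicity of [tau] in the edge set *)

Lemma tau_subrel (T : finType) (e e' : rel T) es ei e's e'i (x : T) :
  subrel e e' -> tau (@SGraph T e es ei) <= tau (@SGraph T e' e's e'i).
Proof.
move=> see'; rewrite (@tau_rooted (SGraph es ei) x) (@tau_rooted (SGraph e's e'i) x).
apply/subset_leq_card/subsetP => f.
by case/rootedP=> fx fv fc; apply/rootedP; split=> // v /fv; exact: see'.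
Qed.

(* Rooting the trees at y, some rooted function of the larger graph sends x
   to y, so it uses the new edge. *)
Lemma tau_proper_subrel (T : finType) (e e' : rel T) es ei e's e'i (x y : T) :
  subrel e e' -> connected (@SGraph T e' e's e'i) -> e' x y -> ~~ e x y ->
  tau (@SGraph T e es ei) < tau (@SGraph T e' e's e'i).
Proof.
move=> see' con e'xy nexy.
rewrite (@tau_rooted (SGraph es ei) y) (@tau_rooted (SGraph e's e'i) y).
apply/proper_card/properP.
split.
  apply/subsetP => f /rootedP[fx fv fc].
  by apply/rootedP; split=> // v /fv; exact: see'.
have [f fP /(_ x e'xy) fxy] := @connected_rooted (SGraph e's e'i) y con.
exists f => //; apply: contraNN nexy => /rootedP[_ /(_ x) + _].
by rewrite fxy; apply; apply: contraTneq e'xy => ->; rewrite e'i.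
Qed.

(** * Minimum vertex cuts and the degree bound *)

Lemma bigminn_attained (I : finType) (P : pred I) (F : I -> nat) m0 :
  \big[minn/m0]_(i | P i) F i = m0 \/
  exists2 i, P i & F i = \big[minn/m0]_(i | P i) F i.
Proof.
elim/big_ind: _ => [|m1 m2 IH1 IH2|i Pi]; first by left.
  by rewrite /minn; case: ifP.
by right; exists i.
Qed.

Lemma bigminn_leq (I : finType) (F : I -> nat) m0 j :
  \big[minn/m0]_i F i <= F j.
Proof.
have := mem_index_enum j; elim: (index_enum I) => // i s IHs.
rewrite in_cons big_cons geq_min => /orP[/eqP <-|/IHs ->]; by rewrite ?leqnn ?orbT.
Qed.

(** All neighbors of [v] lie in [S] or in [A] without [v]; leaving out [v] makes the inequality
    strict. *)
Lemma min_degree_leq (G : sgraph) (S A B : {set G}) v :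
  S :|: A :|: B = setT -> (forall u w, u \in A -> w \in B -> ~~ (u -- w)) ->
  v \in A -> min_degree G < #|S| + #|A|.
Proof.
move=> cov nAB vA; rewrite (cardsD1 v A) vA addnCA add1n ltnS.
apply: leq_trans (bigminn_leq _ _ v) _; apply: leq_trans (leq_card_setU _ _).
apply/subset_leq_card/subsetP => w; rewrite inE => vw.
have : w \in S :|: A :|: B by rewrite cov inE.
rewrite !inE => /orP[/orP[->//|->]|wB]; last by rewrite (negPf (nAB _ _ vA wB)) in vw.
by rewrite andbT; case: eqP vw => [->|]; rewrite ?orbT ?adj_irrefl.
Qed.

Lemma min_cut_split (G : sgraph) r :
  vertex_connectivity G = r -> r.+1 < #|G| ->
  exists S A B : {set G},
    [/\ #|S| = r, #|S| + #|A| + #|B| = #|G|,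
        min_degree G < #|S| + #|A| /\ min_degree G < #|S| + #|B|,
        [disjoint A & B] &
        forall u w, u \in A -> w \in B -> ~~ (u -- w)].
Proof.
rewrite /vertex_connectivity.
(* The default value [#|G|] is excluded by [r.+1 < #|G|]. *)
have [->|[S cutS <-]] := bigminn_attained (@vertex_cut G) (fun S => #|S|) #|G|.
  by move=> ->; lia.
move=> Sr ltr.
have cardS : #|del_vertices S| = #|G| - r.
  rewrite -Sr -(cardsC S) addKn -(card_imset _ val_inj); apply: eq_card => v.
  rewrite !inE; apply/imsetP/idP => [[z _ ->]|nSv]; first exact: (valP z).
  by exists (Sub v nSv).
move: cutS; rewrite /vertex_cut cardS orbC.
(* More than one vertex remains, so deleting [S] disconnects the graph. *)
have -> /= : (#|G| - r == 1) = false by lia.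
case/forallPn=> x /forallPn[y nxy].
(* [A] is one component of the rest, and [B] collects all the others. *)
pose A := [set val z | z in connect (@adj (del_vertices S)) x].
have AS v : v \in A -> v \notin S by case/imsetP=> z _ ->; exact: (valP z).
pose B := ~: (S :|: A).
have cov : S :|: A :|: B = setT by rewrite setUCr.
have cov' : S :|: B :|: A = setT by rewrite setUAC.
have dAB : [disjoint A & B].
  by rewrite -setI_eq0 /B setCU setIC -setIA [_ :&: A]setIC setICr setI0.
have nAB u w : u \in A -> w \in B -> ~~ (u -- w).
  case/imsetP=> z xz ->; rewrite !inE negb_or => /andP[nSw]; apply: contraNN => zw.
  apply/imsetP; exists (Sub w nSw) => //.
  by apply: connect_trans xz (connect1 _).
have nBA u w : u \in B -> w \in A -> ~~ (u -- w).
  by move=> uB wA; rewrite adj_sym nAB.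
have xA : val x \in A by apply/imsetP; exists x => //; exact: connect0.
have yB : val y \in B.
  rewrite !inE negb_or (valP y); apply: contraNN nxy => /imsetP[z xz].
  by move=> /val_inj ->.
exists S, A, B; split=> //; last first.
  by split; [exact: min_degree_leq cov nAB xA|exact: min_degree_leq cov' nBA yB].
rewrite -cardsUI (_ : S :&: A = set0) ?cards0 ?addn0 ?cardsC //.
by apply/setP => v; rewrite !inE; apply/andP => -[vS /AS]; rewrite vS.
Qed.

(** * Colorings and the extremal graph *)

Definition clique_join r a b :=
  join (complete r) (disjoint_union (complete a) (complete b)).

Definition clique_join_color r a b (u : clique_join r a b) : 'I_3 :=
  match u with inl _ => ord0 | inr (inl _) => 1%R | inr (inr _) => 2%:R%R end.

Lemma clique_join_adj r a b : colored_join (@clique_join_color r a b).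
Proof.
by move=> [i|[i|i]] [j|[j|j]] //=; rewrite /complete_adj /= /separated ?andbT.
Qed.

Lemma card_clique_join_color r a b :
  [/\ #|color_class (@clique_join_color r a b) ord0| = r,
      #|color_class (@clique_join_color r a b) 1%R| = a &
      #|color_class (@clique_join_color r a b) 2%:R%R| = b].
Proof.
split.
- rewrite (_ : color_class _ _ = [set (inl i : clique_join r a b) | i : 'I_r]).
    by rewrite card_imset ?card_ord // => i j [].
  apply/setP=> u; rewrite inE; apply/eqP/imsetP => [|[i _ ->] //].
  by case: u => [i|[i|i]] // _; exists i.
- rewrite (_ : color_class _ _ = [set (inr (inl i) : clique_join r a b) | i : 'I_a]).
    by rewrite card_imset ?card_ord // => i j [].
  apply/setP=> u; rewrite inE; apply/eqP/imsetP => [|[i _ ->] //].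
  by case: u => [i|[i|i]] // _; exists i.
- rewrite (_ : color_class _ _ = [set (inr (inr i) : clique_join r a b) | i : 'I_b]).
    by rewrite card_imset ?card_ord // => i j [].
  apply/setP=> u; rewrite inE; apply/eqP/imsetP => [|[i _ ->] //].
  by case: u => [i|[i|i]] // _; exists i.
Qed.

(** Isomorphism is traded for a coloring of [G] itself, the form that the tree count uses.
    Conversely, enumerating the three color classes yields the isomorphism. *)
Lemma isomorphic_colored_join (G : sgraph) r a b :
  isomorphic G (clique_join r a b) <->
  exists c : G -> 'I_3,
    [/\ colored_join c, #|color_class c ord0| = r,
        #|color_class c 1%R| = a & #|color_class c 2%:R%R| = b].
Proof.
split=> [[f f_bij fE]|[c [cG cr ca cb]]].
  have fcl k : color_class (@clique_join_color r a b \o f) k =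
      f @^-1: color_class (@clique_join_color r a b) k.
    by apply/setP => v; rewrite !inE.
  have fon k : {on color_class (@clique_join_color r a b) k, bijective f}.
    exact: onW_bij.
  exists (@clique_join_color r a b \o f).
  have [c0 c1 c2] := card_clique_join_color r a b.
  rewrite !fcl !on_card_preimset // c0 c1 c2; split=> // v w.
  by rewrite -fE clique_join_adj (bij_eq f_bij).
subst r a b.
pose g (u : clique_join #|color_class c ord0| #|color_class c 1%R|
                       #|color_class c 2%:R%R|) : G :=
  match u with inl i => enum_val i
             | inr (inl i) => enum_val i | inr (inr i) => enum_val i end.
have cg u : c (g u) = clique_join_color u.
  by case: u => [i|[i|i]] /=; have := enum_valP i; rewrite inE => /eqP.
have g_inj : injective g.
  move=> u v guv; have := cg u; rewrite guv cg.
  by case: u v guv => [i|[i|i]] [j|[j|j]] //= /enum_val_inj ->.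
have g_bij : bijective g.
  apply: inj_card_bij => //; rewrite !card_sum !card_ord.
  apply: leq_trans (leq_add (leqnn _) (leq_card_setU _ _)).
  apply: leq_trans (leq_card_setU _ _); rewrite -cardsT subset_leq_card //.
  apply/subsetP => v _; rewrite !inE.
  by case: (c v) => [[|[|[]]]].
have [f fK gK] := g_bij; exists f; first by exists g.
by move=> x y; rewrite -{2}[x]gK -{2}[y]gK cG !cg (inj_eq g_inj) clique_join_adj.
Qed.

(** [G] is a spanning subgraph of the colored join [e'] on the same vertices, and a missing edge
    would make its count strictly smaller. *)
Lemma tau_colored_subgraph (G : sgraph) (c : G -> 'I_3) r a b :
  (forall v w, v -- w -> ~~ separated (c v) (c w)) ->
  #|color_class c ord0| = r -> #|color_class c 1%R| = a ->
  #|color_class c 2%:R%R| = b -> 0 < r -> 0 < a -> 0 < b ->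
  let m := r * (r + a + b) ^ (r - 1) * clique_factor r a * clique_factor r b in
  tau G <= m /\ (tau G = m -> colored_join c).
Proof.
case: G c => T e es ei /= c sep cr ca cb r0 a0 b0.
pose e' : rel T := fun v w => (v != w) && ~~ separated (c v) (c w).
have e's : symmetric e' by move=> v w; rewrite /e' eq_sym separatedC.
have e'i : irreflexive e' by move=> v; rewrite /e' eqxx.
have see' : subrel e e'.
  move=> v w vw; rewrite /e' sep // andbT.
  by apply: contraTneq vw => ->; rewrite ei.
have /card_gt0P[x] : 0 < #|color_class (c : SGraph es ei -> _) ord0| by rewrite cr.
rewrite inE => /eqP cx.
rewrite /clique_factor -(@tau_colored_join (SGraph e's e'i) c r a b) //.
split=> [|tauE]; first exact: tau_subrel x see'.
have con : connected (SGraph e's e'i).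
  (* The vertex [x] of color 0 is adjacent to all others. *)
  have cox v : connect e' v x.
    have [->|nvx] := eqVneq v x; first exact: connect0.
    by apply: connect1; rewrite /e' nvx cx /separated andbF.
  apply/forallP => v; apply/forallP => w; apply: connect_trans (cox v) _.
  by rewrite (sym_connect_sym e's) cox.
move=> v w; apply/idP/idP => [/see' //|vw]; apply: contraT => nvw.
by have := tau_proper_subrel es ei see' con vw nvw; rewrite tauE ltnn.
Qed.

(** The smaller side gets color 1; the degree bound for it implies the one for the other side. *)
Lemma min_cut_coloring (G : sgraph) r :
  vertex_connectivity G = r -> r.+1 < #|G| ->
  exists (c : G -> 'I_3) (a b : nat),
    [/\ forall v w, v -- w -> ~~ separated (c v) (c w),
        [/\ #|color_class c ord0| = r, #|color_class c 1%R| = a &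
            #|color_class c 2%:R%R| = b],
        r + a + b = #|G|, min_degree G < r + a & a <= b].
Proof.
move=> kG ltr; have [S [A [B [Sr cardG [dA dB] dAB nAB]]]] := min_cut_split kG ltr.
wlog le_AB : A B cardG dA dB dAB nAB / #|A| <= #|B|.
  move=> wlAB; have [|/ltnW le_BA] := leqP #|A| #|B|; first exact: (wlAB A B).
  apply: (wlAB B A) => //; rewrite 1?addnAC 1?disjoint_sym // => u w uB wA.
  by rewrite adj_sym nAB.
pose c v : 'I_3 := if v \in A then 1%R else if v \in B then 2%:R%R else ord0.
have cA : color_class c 1%R = A.
  by apply/setP => v; rewrite inE /c; do 2?case: ifP.
have cB : color_class c 2%:R%R = B.
  apply/setP => v; rewrite inE /c; case: ifP => [vA|]; last by case: ifP.
  by rewrite (disjointFr dAB vA).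
have card0 : #|color_class c ord0| = r.
  have : #|color_class c ord0| + #|A :|: B| = #|G|.
    rewrite -(cardsC (A :|: B)) addnC; congr (_ + _); apply: eq_card => v.
    by rewrite !inE /c; do 2?case: ifP.
  by move: dAB; rewrite -setI_eq0 => /eqP dAB; rewrite cardsU dAB cards0; lia.
exists c, #|A|, #|B|; rewrite cA cB -Sr; split=> //; last by rewrite Sr.
move=> v w vw.
have nvw : ~~ ((v \in A) && (w \in B)).
  by apply: contraL vw => /andP[vA wB]; exact: nAB.
have nwv : ~~ ((w \in A) && (v \in B)).
  by apply: contraL vw => /andP[wA vB]; rewrite adj_sym nAB.
move: nvw nwv; rewrite /c.
by case: (v \in A); case: (w \in A); case: (v \in B); case: (w \in B).
Qed.

(** * The bound and its equality case *)

Theorem theorem3p1 (r delta n : nat) (G : sgraph)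
    (r_gt0 : 0 < r) (delta_gt0 : 0 < delta) (n_gt0 : 0 < n)
    (le_r_delta : r <= delta) (le_n : 2 * (delta + 1) - r <= n)
    (orderG : #|G| = n) (kappaG : vertex_connectivity G = r)
    (min_degG : min_degree G = delta) :
  let bound := r * n ^ (r - 1) * (delta + 1) ^ (delta - r)
               * (r + n - delta - 1) ^ (n - delta - 2) in
  tau G <= bound /\
  (tau G = bound <->
   isomorphic G
     (join (complete r)
           (disjoint_union (complete (delta - r + 1))
                           (complete (n - delta - 1))))).
Proof.
(* By [r <= delta], r + 2 <= delta + 2 <= 2 (delta + 1) - r <= n. *)
have ltrG : r.+1 < #|G| by lia.
have [c [a [b [sep [cr ca cb] cardG ltd le_ab]]]] := min_cut_coloring kappaG ltrG.
pose a0 := delta - r + 1; pose b0 := n - delta - 1.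
have [a_gt0 b_gt0] : 0 < a /\ 0 < b by lia.
have [a0_gt0 b0_gt0] : 0 < a0 /\ 0 < b0 by rewrite /a0 /b0; lia.
(* The degree bound gives [a0 <= a], and both pairs of sizes sum to n - r, so [a - a0] vertices have
   to move to the larger clique. *)
have aE : a = a0 + (a - a0) by rewrite /a0; lia.
have b0E : b0 = b + (a - a0) by rewrite /a0 /b0; lia.
have nE : n = r + a0 + b0 by rewrite /a0 /b0; lia.
have dE : delta + 1 = r + a0 /\ delta - r = a0 - 1 by rewrite /a0; lia.
have ndE : r + n - delta - 1 = r + b0 /\ n - delta - 2 = b0 - 1 by rewrite /b0; lia.
move=> bound; rewrite -/a0 -/b0.
have boundE : bound =
    r * n ^ (r - 1) * (clique_factor r a0 * clique_factor r b0).
  by rewrite mulnA /bound /clique_factor dE.1 dE.2 ndE.1 ndE.2.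
have isoE := isomorphic_colored_join G r a0 b0; rewrite /clique_join in isoE.
have /= [le_m eq_m] := tau_colored_subgraph sep cr ca cb r_gt0 a_gt0 b_gt0.
have := @clique_factor_max r a0 b (a - a0) r_gt0 a0_gt0.
rewrite -aE -b0E => /(_ le_ab)[le_f eq_f].
have c_gt0 : 0 < r * n ^ (r - 1) by rewrite muln_gt0 r_gt0 expn_gt0 n_gt0.
rewrite cardG orderG -mulnA in le_m eq_m.
have le_b : r * n ^ (r - 1) * (clique_factor r a * clique_factor r b) <= bound.
  by rewrite boundE leq_pmul2l.
split; first exact: leq_trans le_b.
rewrite isoE; split=> [tauE|[c' [cG' cr' ca' cb']]].
  (* Both inequalities between [tau G] and [bound] become equalities: the second forces [a = a0],
     the first that [G] is the full colored join. *)
  have eqb : r * n ^ (r - 1) * (clique_factor r a * clique_factor r b) = bound.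
    by apply/eqP; rewrite eqn_leq le_b -tauE.
  have eq_a : a = a0.
    have := eq_f; rewrite -(eqn_pmul2l c_gt0) -boundE eqb eqxx => /esym/eqP.
    by rewrite {2}aE => ->; rewrite addn0.
  exists c; split=> //; first by apply: eq_m; rewrite tauE eqb.
    by rewrite ca.
  by rewrite cb b0E eq_a subnn addn0.
rewrite boundE (tau_colored_join cG' cr' ca' cb') //.
by rewrite mulnA nE.
Qed.
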